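(* Let $v$ be a compact symmetric operator in $\mathcal H_+=\ell^2(\mathbb Z_+,\mathbb C^N)$. If $v=v_1+v_2$ with $v_1,v_2$ bounded symmetric operators in $\mathcal H_+$ such that $$\int_1^{\infty}\Big(\sqrt{n_{v_1}(r)}+\sqrt{p_{v_2}(r)}\Big)\,dr<\infty ,$$ then $$\int_1^{\infty}\|\theta(\langle\mathbf N\rangle/r)v\|\,dr<\infty .$$
   Context: $N\ge1$ is an integer, $\mathbb Z_+=\{0,1,2,\dots\}$. A bounded symmetric operator $B$ in $\mathcal H_+$ is represented by its matrix $(b_{ij})_{i,j\in\mathbb Z_+}$ of $N\times N$ blocks, $(B\psi)_i=\sum_{j\ge0}b_{ij}\psi_j$, and $$n_B(r):=\Big(\sup_{r\le i\le2r}\sum_{j\ge0}\|b_{ij}\|\Big)\cdot\Big(\sup_{j\ge0}\sum_{r\le i\le2r}\|b_{ij}\|\Big),\qquad p_B(r):=\sum_{r\le i\le2r}\sum_{j\ge0}\|b_{ij}\|^2 .$$ $\mathbf N$ is the operator $(\mathbf N\psi)_j=j\psi_j$ in $\mathcal H_+$; $\langle x\rangle=\sqrt{1+x^2}$; $\theta\in C_0^\infty(\mathbb R)$ is a fixed function with $\theta(x)>0$ if $1<x<2$ and $\theta(x)=0$ otherwise. *)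

(* Defs.v *)
From HB Require Import structures.
From mathcomp Require Import all_boot all_order all_algebra.
From mathcomp Require Import all_classical all_reals all_analysis.
From mathcomp Require Import complex ring lra.

Set Implicit Arguments.
Unset Strict Implicit.
Unset Printing Implicit Defensive.

Import Order.TTheory GRing.Theory Num.Theory.
Import ComplexField.Normc numFieldNormedType.Exports.

Local Open Scope classical_set_scope.
Local Open Scope ring_scope.
Local Open Scope complex_scope.

Section Minkowski.
Context {R : realType}.
Implicit Types a b s S : R.

Lemma sqrD_young a b s : 0 < s ->
  (a + b) ^+ 2 <= (1 + s) * a ^+ 2 + (1 + s^-1) * b ^+ 2.
Proof.
move=> s0.
have -> : (1 + s) * a ^+ 2 + (1 + s^-1) * b ^+ 2 =
          (a + b) ^+ 2 + s^-1 * (s * a - b) ^+ 2.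
  by field; rewrite gt_eqF.
by rewrite lerDl mulr_ge0 ?sqr_ge0// invr_ge0 ltW.
Qed.

Lemma young_sqrD a b S : 0 <= a -> 0 <= b ->
  (forall s, 0 < s -> S <= (1 + s) * a ^+ 2 + (1 + s^-1) * b ^+ 2) ->
  S <= (a + b) ^+ 2.
Proof.
rewrite le_eqVlt => /predU1P[<-|a0].
  move=> _ h; rewrite add0r leNgt; apply/negP => bS.
  have /h : 0 < (1 + b ^+ 2) / (S - b ^+ 2) by rewrite divr_gt0 ?subr_gt0// ltr_pwDl ?sqr_ge0.
  have b1 : 0 < 1 + b ^+ 2 by rewrite ltr_pwDl ?sqr_ge0.
  rewrite expr0n/= mulr0 add0r invf_div leNgt => /negP; apply.
  rewrite mulrDl mul1r -ltrBrDl mulrAC ltr_pdivrMr// ltr_pM2l ?subr_gt0//.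
  by rewrite ltrDr.
rewrite le_eqVlt => /predU1P[<-|b0] h.
  rewrite addr0 leNgt; apply/negP => aS.
  have a2 : 0 < a ^+ 2 by rewrite exprn_gt0.
  have /h : 0 < (S - a ^+ 2) / (2 * a ^+ 2) by rewrite divr_gt0 ?subr_gt0// mulr_gt0.
  rewrite expr0n/= mulr0 addr0 => {}h.
  suff : (1 + (S - a ^+ 2) / (2 * a ^+ 2)) * a ^+ 2 = (S + a ^+ 2) / 2 by lra.
  by field; rewrite gt_eqF.
have /h : 0 < b / a by rewrite divr_gt0.
suff -> : (1 + b / a) * a ^+ 2 + (1 + (b / a)^-1) * b ^+ 2 = (a + b) ^+ 2 by [].
by field; rewrite !gt_eqF.
Qed.

End Minkowski.

Section Euclidean_space.
Context {R : realType} {N : nat}.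

(* C^N, as a fresh copy of the column vectors: 'cV[R[i]]_N itself carries the
   sup norm of its entries. *)
Definition Cvec (R : realType) (N : nat) : Type := 'cV[R[i]]_N.

HB.instance Definition _ := GRing.Lmodule.copy (Cvec R N) 'cV[R[i]]_N.

Definition Cdot (x y : Cvec R N) : R[i] := \sum_k (x k 0)^* * y k 0.

Definition Cnorm (x : Cvec R N) : R := Num.sqrt (\sum_k normc (x k 0) ^+ 2).

Lemma normc_ge0 (z : R[i]) : 0 <= normc z.
Proof. by case: z => a b; exact: sqrtr_ge0. Qed.

Lemma ler_normcD (z w : R[i]) : normc (z + w) <= normc z + normc w.
Proof. exact: le_normcD. Qed.

Lemma Cnorm_ge0 x : 0 <= Cnorm x. Proof. exact: sqrtr_ge0. Qed.

Lemma sqr_Cnorm x : Cnorm x ^+ 2 = \sum_k normc (x k 0) ^+ 2.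
Proof. by rewrite sqr_sqrtr// sumr_ge0// => k _; rewrite sqr_ge0. Qed.

Lemma ler_CnormD x y : Cnorm (x + y) <= Cnorm x + Cnorm y.
Proof.
rewrite -(@ler_pXn2r _ 2) ?nnegrE ?addr_ge0 ?Cnorm_ge0//.
apply: young_sqrD; rewrite ?Cnorm_ge0// => s s0.
rewrite !sqr_Cnorm !mulr_sumr -big_split/= ler_sum// => k _.
apply: le_trans (sqrD_young _ _ s0).
by rewrite ler_pXn2r ?nnegrE ?addr_ge0 ?normc_ge0// mxE ler_normcD.
Qed.

Lemma CnormZ (c : R[i]) x : Cnorm (c *: x) = normc c * Cnorm x.
Proof.
apply/eqP; rewrite -(@eqrXn2 _ 2)// ?mulr_ge0 ?Cnorm_ge0 ?normc_ge0//.
rewrite exprMn !sqr_Cnorm mulr_sumr; apply/eqP/eq_bigr => k _.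
by rewrite mxE normcM exprMn.
Qed.

Lemma Cnorm_eq0 x : Cnorm x = 0 -> x = 0.
Proof.
move/eqP; rewrite sqrtr_eq0 => x0.
have : \sum_k normc (x k 0) ^+ 2 == 0.
  by rewrite eq_le x0 sumr_ge0// => k _; exact: sqr_ge0.
rewrite psumr_eq0 => [|k _]; last exact: sqr_ge0.
move=> /allP xk; apply/colP => k; rewrite mxE; apply: eq0_normc.
by apply/eqP; rewrite -sqrf_eq0; exact/xk/mem_index_enum.
Qed.

Let Cnorm_triangle x y : (Cnorm (x + y))%:C <= (Cnorm x)%:C + (Cnorm y)%:C.
Proof. by rewrite -rmorphD lecR ler_CnormD. Qed.

Let Cnorm_scale (c : R[i]) x : (Cnorm (c *: x))%:C = `|c| * (Cnorm x)%:C.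
Proof. by rewrite CnormZ rmorphM/= normc_def; case: c. Qed.

Let Cnorm_definite x : (Cnorm x)%:C = 0 -> x = 0.
Proof. by move=> /complexI/Cnorm_eq0. Qed.

HB.instance Definition _ := Lmodule_isNormed.Build R[i] (Cvec R N)
  Cnorm_triangle Cnorm_scale Cnorm_definite.

Lemma CvecE x : `|x| = (Cnorm x)%:C. Proof. by []. Qed.

End Euclidean_space.

Section l2_space.
Context {R : realType} {N : nat}.
Implicit Types (x y : nat -> Cvec R N).

Definition sqsum x : \bar R := (\sum_(0 <= j <oo) (Cnorm (x j) ^+ 2)%:E)%E.

Definition l2_pred : {pred nat -> Cvec R N} := mem [set x | (sqsum x < +oo)%E].

Lemma sqsum_ge0 x : (0 <= sqsum x)%E.
Proof. by apply: nneseries_ge0 => j _ _; rewrite lee_fin sqr_ge0. Qed.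

Lemma l2_predP x : reflect (sqsum x < +oo)%E (x \in l2_pred).
Proof. by apply: (iffP idP); rewrite inE. Qed.

Lemma sqsumZ (c : R[i]) x : sqsum (c *: x) = ((normc c ^+ 2)%:E * sqsum x)%E.
Proof.
rewrite /sqsum -nneseriesZl//; last by move=> j _; rewrite lee_fin sqr_ge0.
by apply: eq_eseriesr => j _; rewrite -EFinM -exprMn -CnormZ.
Qed.

Lemma sqsumD_le x y (s : R) : 0 < s ->
  (sqsum (x + y)%R <= (1 + s)%:E * sqsum x + (1 + s^-1)%:E * sqsum y)%E.
Proof.
move=> s0; have sV0 : 0 < s^-1 by rewrite invr_gt0.
rewrite /sqsum -!nneseriesZl; [|by move=> j _; rewrite lee_fin sqr_ge0..].
rewrite -nneseriesD; [|by move=> j _ _; rewrite -EFinM lee_fin mulr_ge0 ?sqr_ge0 ?addr_ge0 ?ltW..].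
apply: lee_nneseries => j *; first by rewrite lee_fin sqr_ge0.
rewrite -!EFinM -EFinD lee_fin (le_trans _ (sqrD_young _ _ s0))//.
by rewrite ler_pXn2r ?nnegrE ?addr_ge0 ?Cnorm_ge0// ler_CnormD.
Qed.

Lemma l2_submod_closed : submod_closed l2_pred.
Proof.
split=> [|c x y /l2_predP xoo /l2_predP yoo]; apply/l2_predP.
  rewrite /sqsum eseries0 ?ltry// => j _ _.
  by rewrite (_ : Cnorm _ = 0) ?expr0n//; apply/complexI; exact: (@normr0 _ (Cvec R N)).
apply: le_lt_trans (sqsumD_le _ _ ltr01) _.
by rewrite lte_add_pinfty// lte_mul_pinfty ?lee_fin ?addr_ge0 ?invr_ge0 ?ler01
  ?sqsum_ge0// sqsumZ lte_mul_pinfty ?lee_fin ?sqr_ge0.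
Qed.

HB.instance Definition _ := GRing.isSubmodClosed.Build _ _ l2_pred l2_submod_closed.

End l2_space.

Record l2 (R : realType) (N : nat) := L2 {
  l2_seq :> nat -> Cvec R N ;
  _ : l2_seq \in l2_pred }.

Section l2_normed.
Context {R : realType} {N : nat}.

HB.instance Definition _ := [isSub of l2 R N for @l2_seq R N].
HB.instance Definition _ := [Choice of l2 R N by <:].
HB.instance Definition _ := [SubChoice_isSubLmodule of l2 R N by <:].

Implicit Types (x y : l2 R N).

Definition l2_norm x : R := Num.sqrt (fine (sqsum x)).

Lemma l2_sqsum x : (sqsum x < +oo)%E. Proof. exact/l2_predP/valP. Qed.

Lemma l2_norm_ge0 x : 0 <= l2_norm x. Proof. exact: sqrtr_ge0. Qed.

Lemma sqsumE x : sqsum x = (l2_norm x ^+ 2)%:E.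
Proof.
rewrite sqr_sqrtr ?fine_ge0 ?sqsum_ge0// fineK// ge0_fin_numE ?sqsum_ge0//.
exact: l2_sqsum.
Qed.

Let l2_triangle x y : (l2_norm (x + y))%:C <= (l2_norm x)%:C + (l2_norm y)%:C.
Proof.
rewrite -rmorphD lecR -(@ler_pXn2r _ 2) ?nnegrE ?addr_ge0 ?l2_norm_ge0//.
apply: young_sqrD; rewrite ?l2_norm_ge0// => s s0.
by rewrite -lee_fin EFinD (EFinM (1 + s)) (EFinM (1 + s^-1)) -!sqsumE sqsumD_le.
Qed.

Let l2_scale (c : R[i]) x : (l2_norm (c *: x))%:C = `|c| * (l2_norm x)%:C.
Proof.
rewrite (_ : `|c| = (normc c)%:C); last by rewrite normc_def; case: c.
rewrite -rmorphM; congr _%:C.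
apply/eqP; rewrite -(@eqrXn2 _ 2)// ?mulr_ge0 ?l2_norm_ge0 ?normc_ge0//.
rewrite -(inj_eq (@EFin_inj R)) -sqsumE exprMn EFinM -sqsumE.
by apply/eqP; exact: sqsumZ.
Qed.

Lemma Cnorm_le_l2 x j : Cnorm (x j) <= l2_norm x.
Proof.
rewrite -(@ler_pXn2r _ 2) ?nnegrE ?Cnorm_ge0 ?l2_norm_ge0//.
rewrite -lee_fin -sqsumE /sqsum.
rewrite (nneseriesD1 (n := j))//; last by move=> k _; rewrite lee_fin sqr_ge0.
by rewrite leeDl// nneseries_ge0// => k _ _; rewrite lee_fin sqr_ge0.
Qed.

Let l2_definite x : (l2_norm x)%:C = 0 -> x = 0.
Proof.
move=> /complexI x0; apply/val_inj/funext => j; apply: Cnorm_eq0.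
by apply/eqP; rewrite eq_le Cnorm_ge0 andbT -x0 Cnorm_le_l2.
Qed.

HB.instance Definition _ := Lmodule_isNormed.Build R[i] (l2 R N)
  l2_triangle l2_scale l2_definite.

Lemma l2E x : `|x| = (l2_norm x)%:C. Proof. by []. Qed.

End l2_normed.

Section l2_dot.
Context {R : realType} {N : nat}.
Implicit Types (x y : l2 R N).

Definition l2_dot x y : R[i] :=
  limn (series (fun j => complex.Re (Cdot (x j) (y j)))) +i*
  limn (series (fun j => complex.Im (Cdot (x j) (y j)))).

Lemma normc_Cdot_le (u w : Cvec R N) :
  normc (Cdot u w) <= Cnorm u ^+ 2 + Cnorm w ^+ 2.
Proof.
apply: (@le_trans _ _ (\sum_k normc ((u k 0)^* * w k 0))).
  rewrite /Cdot; elim/big_ind2 : _ => [|a b c d ab cd|//].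
    by rewrite normc0.
  exact: le_trans (ler_normcD _ _) (lerD ab cd).
rewrite !sqr_Cnorm -big_split/= ler_sum// => k _.
rewrite normcM (_ : normc (u k 0)^* = normc (u k 0)); last first.
  by case: (u k 0) => a b; rewrite /normc /= sqrrN.
have := normc_ge0 (u k 0); have := normc_ge0 (w k 0).
move: (normc _) (normc _) => a b a0 b0; nra.
Qed.

Let is_cvg_part x y (p : R[i] -> R) : (forall z, `|p z| <= normc z) ->
  cvgn (series (fun j => p (Cdot (x j) (y j)))).
Proof.
move=> pz; apply: normed_cvg.
apply: (@series_le_cvg _ _ (fun j => Cnorm (x j) ^+ 2 + Cnorm (y j) ^+ 2)).
- by move=> j; exact: normr_ge0.
- by move=> j; rewrite addr_ge0 ?sqr_ge0.
- by move=> j; exact: le_trans (pz _) (normc_Cdot_le _ _).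
apply: nnseries_is_cvg => [j|]; first by rewrite addr_ge0 ?sqr_ge0.
rewrite (eq_eseriesr (fun j _ => EFinD _ _)).
rewrite nneseriesD; [|by move=> j _ _; rewrite lee_fin sqr_ge0..].
by rewrite lte_add_pinfty// l2_sqsum.
Qed.

Lemma is_cvg_l2_dot_Re x y :
  cvgn (series (fun j => complex.Re (Cdot (x j) (y j)))).
Proof.
apply: is_cvg_part => -[a b] /=; rewrite -sqrtr_sqr ler_wsqrtr//.
by rewrite lerDl sqr_ge0.
Qed.

Lemma is_cvg_l2_dot_Im x y :
  cvgn (series (fun j => complex.Im (Cdot (x j) (y j)))).
Proof.
apply: is_cvg_part => -[a b] /=; rewrite -sqrtr_sqr ler_wsqrtr//.
by rewrite lerDr sqr_ge0.
Qed.

Lemma l2_dotxx x : l2_dot x x = `|x| ^+ 2.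
Proof.
have CdotE (u : Cvec R N) : Cdot u u = (Cnorm u ^+ 2)%:C.
  rewrite sqr_Cnorm /Cdot rmorph_sum; apply: eq_bigr => k _.
  case: (u k 0) => a b; rewrite /normc sqr_sqrtr ?addr_ge0 ?sqr_ge0//.
  by simpc; congr (_ +i* _); ring.
rewrite l2E -rmorphXn /l2_dot; congr (_ +i* _).
  under eq_fun do rewrite CdotE /=.
  apply: EFin_inj; rewrite -sqsumE /sqsum -EFin_lim.
    by congr (limn _); apply/funext => n /=; rewrite sumEFin.
  apply: nnseries_is_cvg => [j|]; [exact: sqr_ge0|exact: l2_sqsum].
under eq_fun do rewrite CdotE /=.
rewrite (_ : series _ = cst 0) ?lim_cst//.
by apply/funext => n; rewrite /series/= big1.
Qed.

End l2_dot.

Section operators.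
Context {R : realType}.

Definition opnorm {V W : normedModType R[i]} (T : V -> W) : \bar R :=
  ereal_sup [set (complex.Re `|T x|)%:E | x in [set x : V | `|x| <= 1]].

Definition bounded_op {V W : normedModType R[i]} (T : V -> W) :=
  exists M : R, forall x, `|T x| <= M%:C * `|x|.

Definition compact_op {V W : normedModType R[i]} (T : V -> W) :=
  forall A, bounded_set A -> precompact (T @` A).

Definition symmetric_op {N : nat} (T : l2 R N -> l2 R N) :=
  forall x y, l2_dot (T x) y = l2_dot x (T y).

End operators.

Section blocks.
Context {R : realType} {N : nat}.

Definition single_seq (j : nat) (u : Cvec R N) : nat -> Cvec R N :=
  fun i => if i == j then u else 0.

Lemma single_l2 j u : single_seq j u \in l2_pred.
Proof.
apply/l2_predP; rewrite /sqsum (nneseriesD1 (n := j))//; last first.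
  by move=> k _; rewrite lee_fin sqr_ge0.
rewrite eseries0 ?adde0 ?ltry// => i _ /= ij.
rewrite /single_seq (negbTE ij).
by rewrite (_ : Cnorm _ = 0) ?expr0n//; apply/complexI; exact: (@normr0 _ (Cvec R N)).
Qed.

Definition single j u : l2 R N := L2 (single_l2 j u).

(* Column l of b_ij is the i-th component of B applied to the l-th basis
   vector of C^N placed at site j; see cvg_block. *)
Definition block (B : l2 R N -> l2 R N) (i j : nat) : 'M[R[i]]_N :=
  \matrix_(k, l) (B (single j (delta_mx l 0)) i) k 0.

Lemma single_is_linear j : linear (single j).
Proof.
move=> c u w; apply/val_inj/funext => i /=.
rewrite [RHS](_ : _ = c *: single_seq j u i + single_seq j w i)//.
by rewrite /single_seq; case: ifPn => // _; rewrite scaler0 addr0.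
Qed.

HB.instance Definition _ j :=
  GRing.isLinear.Build R[i] (Cvec R N) (l2 R N) _ (single j) (single_is_linear j).

Lemma l2_sumE (I : Type) (s : seq I) (F : I -> l2 R N) i :
  (\sum_(k <- s) F k) i = \sum_(k <- s) F k i.
Proof. exact: (big_morph (fun x : l2 R N => x i)). Qed.

Lemma block_mulE (B : {linear l2 R N -> l2 R N}) i j (u : Cvec R N) :
  block B i j *m u = B (single j u) i.
Proof.
have {2}-> : u = \sum_l u l 0 *: (delta_mx l 0 : Cvec R N).
  apply/colP => k; rewrite summxE (bigD1 k)//= big1 => [|l lk].
    by rewrite !mxE !eqxx mulr1 addr0.
  by rewrite !mxE eq_sym (negbTE lk) mulr0.
rewrite !linear_sum l2_sumE; apply/colP => k; rewrite summxE mxE.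
by apply: eq_bigr => l _; rewrite !linearZ !mxE mulrC.
Qed.

Lemma l2_tail_cvg0 (x : l2 R N) :
  l2_norm (x - \sum_(j < n) single j (x j)) @[n --> \oo] --> 0.
Proof.
pose t n : R := fine (\sum_(n <= j <oo) (Cnorm (x j) ^+ 2)%:E)%E.
have -> : (fun n => l2_norm (x - \sum_(j < n) single j (x j))) =
    (fun n => Num.sqrt (t n)).
  apply/funext => n; rewrite /l2_norm /t ereal_series eseries_mkcond.
  congr (Num.sqrt (fine _)); apply: eq_eseriesr => j _.
  rewrite [_ j](_ : _ = x j - (\sum_(k < n) single k (x k)) j)// l2_sumE.
  have Cnorm0 : Cnorm (0 : Cvec R N) = 0.
    by apply/complexI; exact: (@normr0 _ (Cvec R N)).
  case: (leqP n j) => nj.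
    rewrite big1 ?subr0// => k _; rewrite /= /single_seq ifN//.
    by rewrite gtn_eqF// (leq_trans _ nj).
  rewrite (bigD1 (Ordinal nj))//= big1 ?addr0 => [|k kj].
    by rewrite /single_seq eqxx subrr Cnorm0 expr0n.
  by rewrite /single_seq ifN// eq_sym.
rewrite -[X in _ --> X]sqrtr0.
apply: (@cvg_comp _ _ _ t Num.sqrt _ (nbhs (0:R))); last exact: sqrt_continuous.
apply: fine_cvg; apply: nneseries_tail_cvg => [|j _]; first exact: l2_sqsum.
by rewrite lee_fin sqr_ge0.
Qed.

Lemma cvg_block (B : {linear l2 R N -> l2 R N}) (x : l2 R N) i :
  bounded_op B ->
  (fun n => \sum_(j < n) (block B i j *m x j : Cvec R N)) @ \oo --> (B x i : Cvec R N).
Proof.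
move=> [M BM]; apply/cvgrPdist_le => -[e e'] e0.
have {e0} [e0 ->] : 0 < e /\ e' = 0.
  by move: e0; rewrite ltcE/= => /andP[/eqP-> ->].
have M1 : 0 < `|M| + 1 by rewrite ltr_wpDl.
have eM : 0 < e / (`|M| + 1) by rewrite divr_gt0.
have /cvgrPdist_le/(_ _ eM) := l2_tail_cvg0 x.
apply: filterS => n; rewrite sub0r normrN (ger0_norm (l2_norm_ge0 _)) => xn.
have -> : B x i - \sum_(j < n) (block B i j *m x j : Cvec R N) =
    B (x - \sum_(j < n) single j (x j)) i.
  rewrite linearB.
  rewrite [RHS](_ : _ = B x i - B (\sum_(j < n) single j (x j)) i)//.
  rewrite (linear_sum B) l2_sumE.
  apply: (congr1 (fun z : Cvec R N => B x i - z)).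
  by apply: eq_bigr => j _; rewrite block_mulE.
rewrite CvecE complexr0 lecR (le_trans (Cnorm_le_l2 _ _))//.
have := BM (x - \sum_(j < n) single j (x j)).
rewrite !l2E -rmorphM lecR => /le_trans; apply.
rewrite [leRHS](_ : e = (`|M| + 1) * (e / (`|M| + 1))); last first.
  by rewrite mulrCA divff ?mulr1// gt_eqF.
apply: le_trans (ler_wpM2r (l2_norm_ge0 _) (_ : _ <= `|M| + 1)) _.
  by rewrite (le_trans (ler_norm M))// lerDl.
rewrite ler_wpM2l// ltW//.
Qed.

Definition mxnorm (A : 'M[R[i]]_N) : \bar R :=
  opnorm (fun u : Cvec R N => A *m u : Cvec R N).

Definition window (r : R) : pred nat := fun i => r <= i%:R <= 2 * r.

Definition nB (B : l2 R N -> l2 R N) (r : R) : \bar R :=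
  (ereal_sup [set \sum_(0 <= j <oo) mxnorm (block B i j) | i in [set i | window r i]] *
   ereal_sup [set \sum_(0 <= i <oo | window r i) mxnorm (block B i j) | j in [set: nat]])%E.

Definition pB (B : l2 R N -> l2 R N) (r : R) : \bar R :=
  (\sum_(0 <= i <oo | window r i) \sum_(0 <= j <oo) mxnorm (block B i j) ^+ 2)%E.

End blocks.

Section functions_of_N.
Context {R : realType} {N : nat}.

Definition funN_seq (f : R -> R) (x : nat -> Cvec R N) : nat -> Cvec R N :=
  fun j => (f j%:R)%:C *: x j.

(* f(N) for f bounded on the nonnegative integers (see funNE); if f is
   unbounded there, vectors outside the domain of f(N) are sent to 0. *)
Definition funN (f : R -> R) (x : l2 R N) : l2 R N := insubd 0 (funN_seq f x).

Lemma funNE (f : R -> R) (x : l2 R N) j :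
  (exists M, forall k : nat, `|f k%:R| <= M) -> funN f x j = (f j%:R)%:C *: x j.
Proof.
move=> [M fM].
rewrite /funN insubdK//; apply/l2_predP.
rewrite (@le_lt_trans _ _ ((M ^+ 2)%:E * sqsum x)%E)//; last first.
  by rewrite lte_mul_pinfty ?lee_fin ?sqr_ge0// l2_sqsum.
rewrite /sqsum -nneseriesZl; last by move=> k _; rewrite lee_fin sqr_ge0.
apply: lee_nneseries => k *; first by rewrite lee_fin sqr_ge0.
rewrite -EFinM lee_fin /funN_seq CnormZ exprMn ler_wpM2r ?sqr_ge0//.
rewrite /normc/= expr0n addr0 sqrtr_sqr ler_pXn2r ?nnegrE//.
exact: le_trans (fM 0%N).
Qed.

End functions_of_N.

Definition japanese {R : realType} (x : R) : R := Num.sqrt (1 + x ^+ 2).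

Definition Coo_c {R : realType} (f : R -> R) :=
  (forall n x, derivable (f^`(n))%classic x 1) /\ compact (closure [set x | f x != 0]).

Lemma Coo_c_bounded {R : realType} (f : R -> R) :
  Coo_c f -> exists M, forall x, `|f x| <= M.
Proof.
move=> [df cf].
have ctf : continuous f.
  by move=> x; apply/differentiable_continuous/derivable1_diffP; exact: (df 0%N).
have /compact_bounded[M [_ fM]] :
    compact (f @` closure [set x | f x != 0]).
  by apply: continuous_compact cf; exact: continuous_subspaceT.
exists (`|M| + 1) => x; have [->|fx0] := eqVneq (f x) 0.
  by rewrite normr0 addr_ge0.
apply: (fM (`|M| + 1)); first by rewrite ltr_pwDr// ler_norm.
by exists x => //; exact: subset_closure.
Qed.

(* Main.v *)
(* Only the sites i with r < <i> < 2r contribute to theta(<N>/r) v. Those with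
   r <= i <= 2r form the window of n_B and p_B: there the rows of v_1 are bounded
   by sqrt(n_{v_1}(r)) by Schur's test and those of v_2 by sqrt(p_{v_2}(r)) by the
   Hilbert-Schmidt norm. For the remaining sites i < r < <i> one has
   0 < <i>/r - 1 <= 2/(1+r^2), and theta, being differentiable at its zero 1,
   is O(1/(1+r^2)) there, which is integrable because v is bounded. *)
Require Import Defs.
From mathcomp Require Import all_boot all_order all_algebra.
From mathcomp Require Import all_classical all_reals all_analysis.
From mathcomp Require Import measurable_realfun complex ring lra.

Import Order.TTheory GRing.Theory Num.Theory.
Import ComplexField.Normc numFieldNormedType.Exports.

Local Open Scope classical_set_scope.
Local Open Scope ring_scope.

(** * Cauchy-Schwarz inequalities for finite sums *)

(** Discriminant argument: the quadratic form in [quad] is nonnegative because it is a sum of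
    squares. *)
Lemma sqr_sum_mul_le {R : realType} (I : Type) (s : seq I) (P : pred I)
    (a c : I -> R) :
  (\sum_(i <- s | P i) a i * c i) ^+ 2 <=
  (\sum_(i <- s | P i) a i ^+ 2) * (\sum_(i <- s | P i) c i ^+ 2).
Proof.
set p := \sum_(i <- s | P i) a i * c i.
set A := \sum_(i <- s | P i) a i ^+ 2; set C := \sum_(i <- s | P i) c i ^+ 2.
have A0 : 0 <= A by apply: sumr_ge0 => i _; exact: sqr_ge0.
have C0 : 0 <= C by apply: sumr_ge0 => i _; exact: sqr_ge0.
have quad x y : 0 <= x ^+ 2 * A - x * y * p *+ 2 + y ^+ 2 * C.
  have -> : x ^+ 2 * A - x * y * p *+ 2 + y ^+ 2 * C =
            \sum_(i <- s | P i) (x * a i - y * c i) ^+ 2.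
    rewrite /A /C /p mulr_sumr mulr_sumr -sumrMnl mulr_sumr -sumrB -big_split/=.
    by apply: eq_bigr => i _; ring.
  by apply: sumr_ge0 => i _; exact: sqr_ge0.
have [A1|A1] := eqVneq A 0.
  (* Here [quad C p] gives [C * p ^+ 2 <= 0] and [quad 1 p] gives [2 * p ^+ 2 <= C * p ^+ 2], so [p]
     vanishes. *)
  by have := quad C p; have := quad 1 p; rewrite A1; nra.
have {}A1 : 0 < A by rewrite lt_neqAle eq_sym A1.
(* The instance [quad p A] amounts to [0 <= A * (A * C - p ^+ 2)]. *)
have h := quad p A; rewrite -(ler_pM2l A1); nra.
Qed.

(** Splitting each weight into two square roots leaves one factor made of the weights alone, as
    Schur's test requires. *)
Lemma sqr_sum_weight_le {R : realType} (I : Type) (s : seq I) (P : pred I)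
    (b c : I -> R) : (forall i, 0 <= b i) ->
  (\sum_(i <- s | P i) b i * c i) ^+ 2 <=
  (\sum_(i <- s | P i) b i) * (\sum_(i <- s | P i) b i * c i ^+ 2).
Proof.
move=> b0.
have := sqr_sum_mul_le I s P (Num.sqrt \o b) (fun i => Num.sqrt (b i) * c i).
under eq_bigr do rewrite /= mulrA -expr2 sqr_sqrtr//.
under [in X in _ <= X * _ -> _]eq_bigr do rewrite /= sqr_sqrtr//.
by under [in X in _ <= _ * X -> _]eq_bigr do rewrite exprMn sqr_sqrtr//.
Qed.

(** * Integration in [r]: comparison, measurability, and the integral of [1 / (1 + r^2)] *)

Section integration.
Context {R : realType}.

(* [r |-> opnorm (theta(<N>/r) v)] is a supremum over an uncountable family, so
   a comparison of integrals that asks for measurability is not available. *)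
Lemma le_integral_nonmeasurable d (T : measurableType d)
    (mu : {measure set T -> \bar R}) (D : set T) (f g : T -> \bar R) :
  (forall x, D x -> 0 <= f x)%E -> (forall x, D x -> f x <= g x)%E ->
  (\int[mu]_(x in D) f x <= \int[mu]_(x in D) g x)%E.
Proof.
move=> f0 fg; rewrite !ge0_integralE//; last first.
  by move=> x Dx; exact: le_trans (f0 _ Dx) (fg _ Dx).
(* Both integrals are suprema over simple functions lying below the integrand, and those below [f]
   are also below [g]. *)
apply: le_ereal_sup => _ [h hf <-]; exists h => // x.
by apply: le_trans (hf x) _; exact: lee_restrict.
Qed.

Lemma window_ceil_floor (r : R) i :
  window r i = (Num.ceil r <= i%:Z <= Num.floor (2 * r)).
Proof. by rewrite /window ceil_le_int floor_ge_int. Qed.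

(** The values of [Num.ceil r] and [Num.floor (2 * r)] cut the line into countably many intervals on
    which the window, hence [h], is constant. Every preimage is then a countable union of such
    intervals. *)
Lemma measurable_fun_window (D : set R) (h : R -> \bar R) :
  (forall r s, window r = window s -> h r = h s) -> measurable_fun D h.
Proof.
move=> hW; apply: measurable_funTS => _ A _; rewrite setTI.
pose cell (k : int * int) := [set r : R | Num.ceil r = k.1 /\ Num.floor (2 * r) = k.2].
have -> : h @^-1` A = \bigcup_k (cell k `&` h @^-1` A).
  apply/seteqP; split => [r Ar|r [k _ []//]].
  by exists (Num.ceil r, Num.floor (2 * r)).
apply: countable_bigcupT_measurable => // k.
(* A cell either lies entirely in the preimage or misses it. *)
have [[s [[sc sf] sA]]|nA] := pselect (exists s, (cell k `&` h @^-1` A) s).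
  have -> : cell k `&` h @^-1` A = cell k.
    apply/seteqP; split => [r []//|r [rc rf]]; split => //=.
    rewrite (_ : h r = h s)//; apply: hW; apply/funext => i.
    by rewrite !window_ceil_floor sc sf rc rf.
  have -> : cell k = `](k.1 - 1)%:~R, k.1%:~R] `&` `[k.2%:~R / 2, (k.2 + 1)%:~R / 2[.
    apply/seteqP; split => r; rewrite /cell/= !in_itv/=.
      move=> [rc rf]; split; first by rewrite -rc; exact: ceil_itv.
      have := floor_itv (2 * r); rewrite rf => /andP[? ?].
      by apply/andP; split; lra.
    move=> [rc /andP[? ?]]; split; first exact: ceil_def.
    by apply: floor_def; apply/andP; split; lra.
  by apply: measurableI; exact: measurable_itv.
rewrite (_ : _ `&` _ = set0)//.
by apply/seteqP; split => // r Ar; apply: nA; exists r.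
Qed.

Lemma measurable_oneDsqrV (D : set R) :
  measurable_fun D (fun r : R => (oneDsqr r)^-1%:E).
Proof.
apply: measurableT_comp => //; apply: measurable_funTS.
by apply: continuous_measurable_fun; exact: continuous_oneDsqrV.
Qed.

Lemma integral_oneDsqrV_lty :
  (\int[lebesgue_measure]_(r in `[1%R, +oo[) (oneDsqr (r : R))^-1%:E < +oo)%E.
Proof.
(* The bound [pi / 2] is the integral over the larger half-line starting at 0. *)
apply: (@le_lt_trans _ _ (pi / 2)%:E); last exact: ltry.
rewrite -integral0y_oneDsqr; apply: ge0_subset_integral => //.
- exact: measurable_oneDsqrV.
- by move=> x; rewrite /= !in_itv/= !andbT; apply: le_trans.
Qed.

End integration.

(** * Bounds for [B x] on a window in terms of [nB] and [pB] *)

Section window_estimates.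
Local Open Scope complex_scope.
Context {R : realType} {N : nat}.
Implicit Types (B : {linear l2 R N -> l2 R N}) (x : l2 R N) (r : R).

Lemma Cnorm0 : Cnorm (0 : Cvec R N) = 0.
Proof. by apply/complexI; exact: (@normr0 _ (Cvec R N)). Qed.

Lemma Cnorm_sum_le (I : Type) (s : seq I) (F : I -> Cvec R N) :
  Cnorm (\sum_(i <- s) F i) <= \sum_(i <- s) Cnorm (F i).
Proof.
elim/big_ind2 : _ => [|u a w b ua wb|//].
  by rewrite Cnorm0.
exact: le_trans (ler_CnormD _ _) (lerD ua wb).
Qed.

Lemma mulCv0 (A : 'M[R[i]]_N) : (A *m (0 : Cvec R N) : Cvec R N) = 0.
Proof. exact: (@mulmx0 _ N N 1 A). Qed.

Lemma mxnorm_ge0 (A : 'M[R[i]]_N) : (0 <= mxnorm A)%E.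
Proof.
apply: ereal_sup_ubound; exists 0 => /=; first by rewrite normr0 ler01.
by rewrite mulCv0 Cnorm0.
Qed.

Lemma Cnorm_mulmx_le (A : 'M[R[i]]_N) (u : Cvec R N) :
  ((Cnorm (A *m u : Cvec R N))%:E <= mxnorm A * (Cnorm u)%:E)%E.
Proof.
have [u0|u0] := eqVneq (Cnorm u) 0.
  by rewrite u0 mule0 (Cnorm_eq0 u0) mulCv0 Cnorm0.
have {}u0 : 0 < Cnorm u by rewrite lt_neqAle eq_sym u0 Cnorm_ge0.
have normcR (a : R) : 0 <= a -> normc a%:C = a.
  by move=> a0; rewrite /normc/= expr0n addr0 sqrtr_sqr ger0_norm.
have V0 : 0 <= (Cnorm u)^-1 by rewrite invr_ge0 ltW.
rewrite -lee_pdivrMr//; apply: ereal_sup_ubound.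
exists (((Cnorm u)^-1)%:C *: u) => /=.
  by rewrite CvecE CnormZ normcR// mulVf ?gt_eqF.
rewrite -scalemxAr -EFinM mulrC -[in RHS](normcR _ V0).
exact: (congr1 EFin (CnormZ _ (A *m u : Cvec R N))).
Qed.

Lemma l2_norm_single j (u : Cvec R N) : l2_norm (single j u) = Cnorm u.
Proof.
rewrite /l2_norm /sqsum (nneseriesD1 (n := j))//; last first.
  by move=> k _; rewrite lee_fin sqr_ge0.
rewrite eseries0 => [|i _ /= ij]; last first.
  by rewrite /single_seq (negbTE ij) Cnorm0 expr0n.
by rewrite adde0 /= /single_seq eqxx sqrtr_sqr ger0_norm// Cnorm_ge0.
Qed.

Lemma bounded_op_ge0 (T : l2 R N -> l2 R N) : bounded_op T ->
  exists2 M, 0 <= M & forall x, l2_norm (T x) <= M * l2_norm x.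
Proof.
move=> [M TM]; exists `|M| => // x; have := TM x.
rewrite !l2E -rmorphM lecR => /le_trans; apply.
by rewrite ler_wpM2r ?l2_norm_ge0 ?ler_norm.
Qed.

(** A block is a compression of [B] to two sites, so any bound for [B] bounds it too. Finiteness
    lets later estimates pass to real numbers through [fine]. *)
Lemma mxnorm_block_fin_num B i j : bounded_op B ->
  mxnorm (block B i j) \is a fin_num.
Proof.
move=> /bounded_op_ge0[M M0 BM].
rewrite ge0_fin_numE ?mxnorm_ge0//; apply: (@le_lt_trans _ _ M%:E); last exact: ltry.
apply: ge_ereal_sup => _ [u u1 <-]; rewrite lee_fin block_mulE CvecE /=.
apply: le_trans (Cnorm_le_l2 _ _) _; apply: le_trans (BM _) _.
rewrite l2_norm_single -[leRHS]mulr1 ler_wpM2l//.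
by move: u1; rewrite /= CvecE (_ : 1 = 1%:C)// lecR.
Qed.

Lemma sqr_Cnorm_cvg_block B x i : bounded_op B ->
  (Cnorm (\sum_(j < n) (block B i j *m x j : Cvec R N)) ^+ 2)%:E @[n --> \oo]
    --> (Cnorm (B x i) ^+ 2)%:E.
Proof.
move=> Bb; apply: cvg_EFin; first by near=> n.
rewrite /comp/=; apply: (@cvg_comp _ _ _ _ (fun y : R => y ^+ 2) _ (nbhs (Cnorm (B x i)))).
  apply/cvgrPdist_le => e e0.
  have /cvgrPdist_le/(_ e%:C) := cvg_block Bb (x := x) (i := i).
  rewrite ltcR => /(_ e0); apply: filterS => n; rewrite CvecE lecR => h.
  set s := (X in Cnorm (_ - X)) in h *.
  (* [h1] and [h2] are the two halves of the reverse triangle inequality. *)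
  have h1 : Cnorm (B x i) <= e + Cnorm s.
    by apply: le_trans (lerD h (lexx _)); rewrite -{1}(subrK s (B x i)) ler_CnormD.
  have h2 : Cnorm s <= e + Cnorm (B x i).
    have hN : Cnorm (s - B x i) = Cnorm (B x i - s).
      by apply: complexI; rewrite -!CvecE distrC.
    rewrite -hN in h.
    by apply: le_trans (lerD h (lexx _)); rewrite -{1}(subrK (B x i) s) ler_CnormD.
  by rewrite ler_norml; apply/andP; split; lra.
exact: exprn_continuous.
Unshelve. all: by end_near. Qed.

(** Common reduction of both window estimates to finite sums of block norms: row [i] of [B x] is the
    limit of its truncations to [n] columns, and a bound uniform in [n] survives the limit. *)
Lemma window_sum_le B x r m (K : \bar R) : bounded_op B ->
  (forall n, \sum_(i < m | window r i)
    ((\sum_(j < n) fine (mxnorm (block B i j)) * Cnorm (x j)) ^+ 2)%:E <= K)%E ->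
  (\sum_(i < m | window r i) (Cnorm (B x i) ^+ 2)%:E <= K)%E.
Proof.
move=> Bb h.
have cvB : (\sum_(i < m | window r i)
    (Cnorm (\sum_(j < n) (block B i j *m x j : Cvec R N)) ^+ 2)%:E)%E @[n --> \oo] -->
    (\sum_(i < m | window r i) (Cnorm (B x i) ^+ 2)%:E)%E.
  apply: cvg_nnesum => i _; last exact: sqr_Cnorm_cvg_block.
  by near=> n; rewrite lee_fin sqr_ge0.
rewrite -(cvg_lim _ cvB)//; apply: lime_le; first exact: cvgP cvB.
near=> n; apply: le_trans (h n); apply: lee_sum => i _; rewrite lee_fin.
rewrite ler_sqr ?nnegrE ?Cnorm_ge0//; last first.
  by apply: sumr_ge0 => j _; rewrite mulr_ge0 ?Cnorm_ge0 ?fine_ge0 ?mxnorm_ge0.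
apply: le_trans (Cnorm_sum_le _ _ _) _; apply: ler_sum => j _.
by rewrite -lee_fin EFinM fineK ?mxnorm_block_fin_num// Cnorm_mulmx_le.
Unshelve. all: by end_near. Qed.

Lemma partial_sum_le_nneseries (f : nat -> \bar R) (P : pred nat) n :
  (forall i, 0 <= f i)%E ->
  (\sum_(i < n | P i) f i <= \sum_(0 <= i <oo | P i) f i)%E.
Proof.
by move=> f0; rewrite -(big_mkord P) nneseries_lim_ge.
Qed.

Lemma sqsum_ge_partial x n : (\sum_(j < n) (Cnorm (x j) ^+ 2)%:E <= sqsum x)%E.
Proof.
by apply: partial_sum_le_nneseries => j; rewrite lee_fin sqr_ge0.
Qed.

Lemma window_neq0 (r : R) : 1 <= r -> exists i, window r i.
Proof.
(* Since [1 <= r], the ceiling of [r] is below [r + 1 <= 2 * r]. *)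
move=> r1; exists `|Num.ceil r|%N; rewrite /window.
have c0 : (0 <= Num.ceil r)%R by rewrite -(ceil0 R) ceil_le// (le_trans _ r1).
have -> : `|Num.ceil r|%:R = (Num.ceil r)%:~R :> R.
  by rewrite -[in RHS](gez0_abs c0).
have := ceil_itv r; rewrite intrD => /andP[? ?].
by apply/andP; split; lra.
Qed.

(** A supremum over an empty window would be [-oo]; [1 <= r] guarantees a site in the window. *)
Lemma nB_factors_ge0 B r : 1 <= r ->
  (0 <= ereal_sup [set \sum_(0 <= j <oo) mxnorm (block B i j) | i in [set i | window r i]])%E /\
  (0 <= ereal_sup [set \sum_(0 <= i <oo | window r i) mxnorm (block B i j) | j in [set: nat]])%E.
Proof.
move=> /window_neq0[k kr]; split.
  apply: le_trans (ereal_sup_ubound (_ : [set _ | _ in _] _)); last by exists k.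
  by apply: nneseries_ge0 => *; exact: mxnorm_ge0.
apply: le_trans (ereal_sup_ubound (_ : [set _ | _ in _] _)); last by exists 0%N.
by apply: nneseries_ge0 => *; exact: mxnorm_ge0.
Qed.

(* Schur's test: Cauchy-Schwarz with the weights [mxnorm (block B i j)]. *)
Lemma window_nB_le B x r m : bounded_op B -> 1 <= r ->
  (\sum_(i < m | window r i) (Cnorm (B x i) ^+ 2)%:E <= nB B r * sqsum x)%E.
Proof.
move=> Bb r1; apply: window_sum_le => // n.
have b0 i j : 0 <= fine (mxnorm (block B i j)) by rewrite fine_ge0 ?mxnorm_ge0.
rewrite /nB.
set S1 := (X in (X * _ * _)%E); set S2 := (X in (_ * X * _)%E) .
have [S10 S20] : (0 <= S1)%E /\ (0 <= S2)%E := nB_factors_ge0 B _ r1.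
have h1 i : window r i -> (\sum_(0 <= j <oo) mxnorm (block B i j) <= S1)%E.
  by move=> ir; apply: ereal_sup_ubound; exists i.
have h2 j : (\sum_(0 <= i <oo | window r i) mxnorm (block B i j) <= S2)%E.
  by apply: ereal_sup_ubound; exists j.
clearbody S1 S2.
(* Cauchy-Schwarz in row [i] produces the row sum, at most [S1], times a weighted sum of squares. *)
apply: (@le_trans _ _ (\sum_(i < m | window r i)
  S1 * (\sum_(j < n) fine (mxnorm (block B i j)) * Cnorm (x j) ^+ 2)%:E)%E).
  apply: lee_sum => i ir.
  apply: (@le_trans _ _ ((\sum_(j < n) fine (mxnorm (block B i j))) *
    (\sum_(j < n) fine (mxnorm (block B i j)) * Cnorm (x j) ^+ 2))%:E).
    by rewrite lee_fin; apply: sqr_sum_weight_le.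
  rewrite EFinM; apply: lee_wpmul2r.
    by rewrite lee_fin sumr_ge0// => j _; rewrite mulr_ge0 ?sqr_ge0.
  apply: le_trans (h1 _ ir).
  rewrite -sumEFin; under eq_bigr do rewrite fineK ?mxnorm_block_fin_num//.
  by apply: (@partial_sum_le_nneseries _ xpredT) => j; exact: mxnorm_ge0.
rewrite -ge0_sume_distrr; last first.
  by move=> i _; rewrite lee_fin sumr_ge0// => j _; rewrite mulr_ge0 ?sqr_ge0.
rewrite -muleA; apply: lee_wpmul2l => //.
under eq_bigr do rewrite -sumEFin.
(* Summing over [i] first makes the column sums appear, each at most [S2]. *)
rewrite exchange_big/=.
apply: le_trans (lee_wpmul2l S20 (sqsum_ge_partial x n)).
rewrite ge0_sume_distrr => [|j _]; last by rewrite lee_fin sqr_ge0.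
apply: lee_sum => j _.
under eq_bigr do rewrite EFinM.
rewrite -ge0_sume_distrl => [|i _]; last by rewrite lee_fin.
apply: lee_wpmul2r; first by rewrite lee_fin sqr_ge0.
apply: le_trans (h2 j).
under eq_bigr do rewrite fineK ?mxnorm_block_fin_num//.
by apply: (@partial_sum_le_nneseries (fun i => mxnorm (block B i j))) => i; exact: mxnorm_ge0.
Qed.

Lemma pB_ge0 (T : l2 R N -> l2 R N) r : (0 <= pB T r)%E.
Proof.
apply: nneseries_ge0 => i _ _; apply: nneseries_ge0 => j _ _.
by rewrite expe_ge0 ?mxnorm_ge0.
Qed.

(** Cauchy-Schwarz in each row separates the squared block norms of the row from the squared norm of
    [x]; summing the former over the window gives the Hilbert-Schmidt quantity [pB]. *)
Lemma window_pB_le B x r m : bounded_op B ->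
  (\sum_(i < m | window r i) (Cnorm (B x i) ^+ 2)%:E <= pB B r * sqsum x)%E.
Proof.
move=> Bb; apply: window_sum_le => // n.
pose F i := (\sum_(0 <= j <oo) mxnorm (block B i j) ^+ 2)%E.
have F0 i : (0 <= F i)%E.
  by apply: nneseries_ge0 => j _ _; rewrite expe_ge0 ?mxnorm_ge0.
apply: (@le_trans _ _ (\sum_(i < m | window r i) F i * sqsum x)%E); last first.
  rewrite -ge0_sume_distrl//; apply: lee_wpmul2r; first exact: sqsum_ge0.
  exact: (@partial_sum_le_nneseries F).
apply: lee_sum => i _.
apply: (@le_trans _ _ ((\sum_(j < n) fine (mxnorm (block B i j)) ^+ 2) *
    (\sum_(j < n) Cnorm (x j) ^+ 2))%:E).
  by rewrite lee_fin; apply: sqr_sum_mul_le.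
rewrite EFinM; apply: lee_pmul.
- by rewrite lee_fin sumr_ge0// => j _; rewrite sqr_ge0.
- by rewrite lee_fin sumr_ge0// => j _; rewrite sqr_ge0.
- rewrite -sumEFin.
  under eq_bigr do rewrite EFin_expe fineK ?mxnorm_block_fin_num//.
  apply: (@partial_sum_le_nneseries (fun j => mxnorm (block B i j) ^+ 2)%E xpredT) => j.
  by rewrite expe_ge0 ?mxnorm_ge0.
- by rewrite -sumEFin; exact: sqsum_ge_partial.
Qed.

(** [funN f] is diagonal, so only the sites in [P] count, each scaled by at most [c]. The square
    root is the extended one because [K] may be [+oo]. *)
Lemma funN_norm_le (f : R -> R) (c : R) (P : pred nat) (K : \bar R) x :
  (forall k : nat, `|f k%:R| <= c) -> (forall k : nat, ~~ P k -> f k%:R = 0) ->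
  (0 <= K)%E -> (forall m, \sum_(i < m | P i) (Cnorm (x i) ^+ 2)%:E <= K)%E ->
  ((l2_norm (funN f x))%:E <= c%:E * sqrte K)%E.
Proof.
move=> fc fP K0 xK.
have c0 : 0 <= c := le_trans (normr_ge0 _) (fc 0%N).
have h : (sqsum (funN f x) <= (c ^+ 2)%:E * K)%E.
  apply: lime_le; first by apply: is_cvg_nneseries => i _ _; rewrite lee_fin sqr_ge0.
  near=> m; rewrite big_mkord.
  apply: le_trans (lee_wpmul2l _ (xK m)); last by rewrite lee_fin sqr_ge0.
  rewrite ge0_sume_distrr => [|i _]; last by rewrite lee_fin sqr_ge0.
  rewrite [leRHS]big_mkcond; apply: lee_sum => i _.
  rewrite funNE; last by exists c.
  rewrite CnormZ /normc/= expr0n addr0 sqrtr_sqr.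
  case: ifPn => [_|/fP ->]; last by rewrite normr0 mul0r expr0n.
  by rewrite -EFinM lee_fin exprMn ler_wpM2r ?sqr_ge0// ler_sqr ?nnegrE.
move: h; rewrite sqsumE -lee_sqrt; last by rewrite mule_ge0// lee_fin sqr_ge0.
rewrite sqrteM ?lee_fin ?sqr_ge0// /sqrte/= !sqrtr_sqr.
by rewrite !ger0_norm// l2_norm_ge0.
Unshelve. all: by end_near. Qed.

End window_estimates.

(** * Smallness of [theta] at the sites below [r] *)

(** Within distance [d] of [a] the difference quotient is at most [|l| + 1], with [l] the derivative
    at [a]; farther away the global bound [M] is at most [M / d] times the distance. The constant
    adds the two. *)
Lemma Coo_c_le_dist {R : realType} (f : R -> R) a : Coo_c f -> f a = 0 ->
  exists2 C, 0 <= C & forall x, `|f x| <= C * `|x - a|.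
Proof.
move=> fC fa0; have [M fM] := Coo_c_bounded fC.
have M0 : 0 <= M := le_trans (normr_ge0 _) (fM 0).
have := fC.1 0%N a; rewrite derive1n0 => /cvg_ex[l hl].
have : `|l| < `|l| + 1 by rewrite ltrDl.
move=> /(cvgr_norm_le _ hl) /nbhs_ballP[d /= d0 hd].
exists (`|l| + 1 + M / d); first by rewrite addr_ge0 ?addr_ge0 ?divr_ge0// ltW.
move=> x; have [->|xa] := eqVneq x a; first by rewrite fa0 normr0 mulr_ge0// addr_ge0 ?addr_ge0 ?divr_ge0// ltW.
have xa0 : 0 < `|x - a| by rewrite normr_gt0 subr_eq0.
have [xd|xd] := ltP `|x - a| d.
  have := hd (x - a); rewrite /ball/= sub0r normrN subr_eq0 => /(_ xd xa).
  rewrite /GRing.scale/= mulr1 subrK fa0 subr0 normrM normfV.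
  rewrite mulrC ler_pdivrMr// => /le_trans; apply.
  by rewrite ler_wpM2r// lerDl divr_ge0// ltW.
apply: le_trans (fM x) _; rewrite mulrDl -[leLHS]add0r lerD ?mulr_ge0//.
by rewrite mulrAC ler_pdivlMr// ler_wpM2l.
Qed.

Section localization.
Context {R : realType}.

Lemma japanese_ge (x : R) : 0 <= x -> x <= japanese x.
Proof.
move=> x0; rewrite -[leLHS](ger0_norm x0) -sqrtr_sqr ler_wsqrtr//.
by rewrite lerDr.
Qed.

(** One has [(t - 1) * (t + 1) * r ^+ 2 = 1 + x ^+ 2 - r ^+ 2 <= 1] with [t + 1 > 2], which controls
    [(t - 1) * r ^+ 2]; as [1 <= r], this also controls [t - 1]. *)
Lemma japanese_div_sub1_le (x r : R) : 0 <= x -> x < r -> 1 <= r ->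
  1 < japanese x / r -> `|japanese x / r - 1| <= 2 / oneDsqr r.
Proof.
move=> x0 xr r1; set t := japanese x / r => t1.
have r0 : 0 < r by lra.
have D0 : 0 < oneDsqr r by apply: lt_le_trans (oneDsqr_ge1 r).
have t2 : t ^+ 2 * r ^+ 2 = 1 + x ^+ 2.
  rewrite -exprMn /t divfK ?gt_eqF// /japanese sqr_sqrtr//.
  by rewrite addr_ge0 ?sqr_ge0.
rewrite ger0_norm ?subr_ge0 ?(ltW t1)// ler_pdivlMr// /oneDsqr.
have : x ^+ 2 <= r ^+ 2 by rewrite ler_sqr ?nnegrE// ltW.
have h : (t - 1) * r ^+ 2 * (t + 1) <= 1 by nra.
have p0 : 0 <= (t - 1) * r ^+ 2 by rewrite mulr_ge0 ?sqr_ge0 ?subr_ge0 ?(ltW t1).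
have : t - 1 <= (t - 1) * r ^+ 2.
  by rewrite ler_peMr ?subr_ge0 ?(ltW t1)// exprn_ege1.
nra.
Qed.

End localization.

(** * Bound for the operator norm at a fixed [r] *)

Section opnorm_localization.
Context {R : realType} {N : nat}.
Local Open Scope complex_scope.

Lemma l2_normD_le (x y : l2 R N) : l2_norm (x + y) <= l2_norm x + l2_norm y.
Proof. by have := ler_normD x y; rewrite !l2E -rmorphD lecR. Qed.

Lemma opnorm_le (T : l2 R N -> l2 R N) (K : \bar R) :
  (forall x, l2_norm x <= 1 -> ((l2_norm (T x))%:E <= K)%E) -> (opnorm T <= K)%E.
Proof.
move=> TK; apply: ge_ereal_sup => _ [x x1 <-]; rewrite l2E /=; apply: TK.
by move: x1; rewrite /= l2E (_ : 1 = 1%:C)// lecR.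
Qed.

Lemma sqsum_le1 (x : l2 R N) : l2_norm x <= 1 -> (sqsum x <= 1)%E.
Proof. by move=> x1; rewrite sqsumE lee_fin expr_le1// l2_norm_ge0. Qed.

Lemma funN_window_norm_le (f : R -> R) (c r : R) (B : l2 R N -> l2 R N)
    (k : \bar R) x :
  (forall k : nat, `|f k%:R| <= c) -> (forall k : nat, ~~ window r k -> f k%:R = 0) ->
  (0 <= k)%E -> l2_norm x <= 1 ->
  (forall m, \sum_(i < m | window r i) (Cnorm (B x i) ^+ 2)%:E <= k * sqsum x)%E ->
  ((l2_norm (funN f (B x)))%:E <= c%:E * sqrte k)%E.
Proof.
move=> fc fW k0 x1 BK; apply: (funN_norm_le f c (window r)) => // m.
apply: le_trans (BK m) _; rewrite -[leRHS]mule1.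
by apply: lee_wpmul2l => //; exact: sqsum_le1.
Qed.

(** The symbol [g] is cut at [r]: the small part [g1] acts on [v] as a whole, and [g2], supported in
    the window, acts on [v1] and [v2] separately. *)
Lemma opnorm_localization_le (theta : R -> R) (C M : R)
    (v v1 v2 : {linear l2 R N -> l2 R N}) (Mv r : R) :
  (forall x, ~~ (1 < x < 2) -> theta x = 0) ->
  0 <= C -> (forall x, `|theta x| <= C * `|x - 1|) -> (forall x, `|theta x| <= M) ->
  0 <= Mv -> (forall x, l2_norm (v x) <= Mv * l2_norm x) ->
  bounded_op v1 -> bounded_op v2 -> (forall x, v x = v1 x + v2 x) -> 1 <= r ->
  (opnorm (funN (fun x : R => theta (japanese x / r)%R) \o v) <=
   (2 * C * Mv)%:E * (oneDsqr r)^-1%:E +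
   M%:E * (sqrte (nB v1 r) + sqrte (pB v2 r)))%E.
Proof.
move=> theta0 C0 thetaC thetaM Mv0 vMv v1b v2b vE r1.
have r0 : 0 < r by exact: lt_le_trans r1.
have D0 : 0 < oneDsqr r by apply: lt_le_trans (oneDsqr_ge1 r).
have M0 : 0 <= M := le_trans (normr_ge0 _) (thetaM 0).
pose g x := theta (japanese x / r).
pose g1 x := if x < r then g x else 0.
pose g2 x := if x < r then 0 else g x.
have gM x : `|g x| <= M by exact: thetaM.
have g1D (k : nat) : `|g1 k%:R| <= 2 * C / oneDsqr r.
  rewrite /g1; case: ifPn => [kr|_]; last by rewrite normr0 divr_ge0 ?mulr_ge0// ltW.
  (* When [japanese k%:R / r] does not exceed 1, [theta] vanishes there; otherwise its linear bound
     at 1 applies. *)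
  have [t1|t1] := ltP 1 (japanese k%:R / r).
    apply: le_trans (thetaC _) _; rewrite (mulrC 2) -mulrA ler_wpM2l//.
    exact: japanese_div_sub1_le.
  rewrite /g theta0; first by rewrite normr0 divr_ge0 ?mulr_ge0// ltW.
  by rewrite negb_and -leNgt t1.
have g1M x : `|g1 x| <= M by rewrite /g1; case: ifP => // _; rewrite normr0.
have g2M x : `|g2 x| <= M by rewrite /g2; case: ifP => // _; rewrite normr0.
have g2W (k : nat) : ~~ window r k -> g2 k%:R = 0.
  rewrite /g2 /window; case: ltP => //= kr kr2; apply: theta0.
  (* A site beyond [2 * r] has [japanese k%:R] at least [2 * r], outside the support interval of
     [theta]. *)
  rewrite negb_and -!leNgt ler_pdivlMr//; apply/orP; right.
  by apply: le_trans (japanese_ge _ (ler0n _ k)); rewrite ltW// ltNge.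
apply: opnorm_le => x x1 /=.
have -> : funN (fun x => theta (japanese x / r)) (v x) =
    funN g1 (v x) + (funN g2 (v1 x) + funN g2 (v2 x)).
  apply/val_inj/funext => i.
  have E0 : funN g (v x) i = (g i%:R)%:C *: (v1 x i + v2 x i).
    by rewrite -[_ + _]/((v1 x + v2 x) i) -vE; apply: funNE; exists M.
  have E1 : funN g1 (v x) i = (g1 i%:R)%:C *: (v1 x i + v2 x i).
    by rewrite -[_ + _]/((v1 x + v2 x) i) -vE; apply: funNE; exists M.
  have E2 (y : l2 R N) : funN g2 y i = (g2 i%:R)%:C *: y i by apply: funNE; exists M.
  have E12 (y z : Cvec R N) : (g i%:R)%:C *: (y + z) = (g1 i%:R)%:C *: (y + z) +
      ((g2 i%:R)%:C *: y + (g2 i%:R)%:C *: z).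
    rewrite -scalerDr -scalerDl -rmorphD.
    by rewrite /g1 /g2; case: ifP => _; rewrite ?addr0 ?add0r.
  apply: etrans E0 (etrans (E12 _ _) _); apply: esym.
  exact: (congr2 +%R E1 (congr2 +%R (E2 (v1 x)) (E2 (v2 x)))).
apply: (@le_trans _ _ ((l2_norm (funN g1 (v x)))%:E +
    ((l2_norm (funN g2 (v1 x)))%:E + (l2_norm (funN g2 (v2 x)))%:E))%E).
  rewrite -!EFinD lee_fin (le_trans (l2_normD_le _ _))// lerD2l.
  exact: l2_normD_le.
apply: leeD.
  (* No restriction on the sites is needed for [g1]: its size alone supplies the decay in [r]. *)
  apply: (@le_trans _ _ ((2 * C / oneDsqr r)%:E * sqrte (sqsum (v x)))%E).
    apply: (funN_norm_le g1 _ xpredT) => //; first exact: sqsum_ge0.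
    exact: sqsum_ge_partial.
  rewrite sqsumE /sqrte sqrtr_sqr ger0_norm ?l2_norm_ge0// -!EFinM lee_fin.
  rewrite mulrAC ler_wpM2r ?invr_ge0 ?(ltW D0)// ler_wpM2l ?mulr_ge0//.
  by apply: le_trans (vMv x) _; rewrite -[leRHS]mulr1 ler_wpM2l.
rewrite ge0_muleDr ?sqrte_ge0//.
have [nB1 nB2] := nB_factors_ge0 v1 _ r1.
apply: leeD.
  exact: (funN_window_norm_le g2 M r v1 (nB v1 r) x (fun k => g2M k%:R) g2W
    (mule_ge0 nB1 nB2) x1 (fun m => window_nB_le v1 x r m v1b r1)).
exact: (funN_window_norm_le g2 M r v2 (pB v2 r) x (fun k => g2M k%:R) g2W
  (pB_ge0 v2 r) x1 (fun m => window_pB_le v2 x r m v2b)).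
Qed.

Lemma opnorm_ge0 (T : l2 R N -> l2 R N) : T 0 = 0 -> (0 <= opnorm T)%E.
Proof.
move=> T0; apply: ereal_sup_ubound; exists 0; first by rewrite /= normr0 ler01.
by rewrite T0 normr0.
Qed.

End opnorm_localization.

(** * Integration of the bound at fixed [r] *)

Theorem corollary1p3 (R : realType) (N : nat) (N_ge1 : (1 <= N)%N)
    (theta : R -> R) (theta_Coo_c : Coo_c theta)
    (theta_gt0 : forall x : R, 1 < x < 2 -> 0 < theta x)
    (theta_eq0 : forall x : R, ~~ (1 < x < 2) -> theta x = 0)
    (v : {linear l2 R N -> l2 R N}) (v_compact : compact_op v)
    (v_symmetric : symmetric_op v)
    (v1 v2 : {linear l2 R N -> l2 R N})
    (v1_bounded : bounded_op v1) (v1_symmetric : symmetric_op v1)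
    (v2_bounded : bounded_op v2) (v2_symmetric : symmetric_op v2)
    (v_sum : forall psi : l2 R N, v psi = v1 psi + v2 psi) :
  (\int[lebesgue_measure]_(r in `[1%R, +oo[) (sqrte (nB v1 r) + sqrte (pB v2 r))
     < +oo)%E ->
  (\int[lebesgue_measure]_(r in `[1%R, +oo[)
     opnorm (funN (fun x : R => theta (japanese x / r)%R) \o v) < +oo)%E.
Proof.
move=> vint.
have [C C0 thetaC] : exists2 C, 0 <= C & forall x, `|theta x| <= C * `|x - 1|.
  by apply: Coo_c_le_dist => //; apply: theta_eq0; rewrite ltxx.
have [M thetaM] := Coo_c_bounded theta_Coo_c.
have M0 : 0 <= M := le_trans (normr_ge0 _) (thetaM 0).
have [M1 M10 v1M] := bounded_op_ge0 _ v1_bounded.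
have [M2 M20 v2M] := bounded_op_ge0 _ v2_bounded.
have vM x : l2_norm (v x) <= (M1 + M2) * l2_norm x.
  by rewrite v_sum mulrDl (le_trans (l2_normD_le _ _))// lerD.
have oneDsqrV_ge0 (r : R) : (0 <= (oneDsqr r)^-1%:E)%E.
  by rewrite lee_fin invr_ge0 (le_trans _ (oneDsqr_ge1 r)).
(* [nB] and [pB] depend on [r] only through the window. *)
have mS (D : set R) :
    measurable_fun D (fun r : R => sqrte (nB v1 r) + sqrte (pB v2 r))%E.
  by apply: measurable_fun_window => r s rs; rewrite /nB /pB rs.
apply: (@le_lt_trans _ _ (\int[lebesgue_measure]_(r in `[1%R, +oo[)
   ((2 * C * (M1 + M2))%:E * (oneDsqr r)^-1%:E +
   M%:E * (sqrte (nB v1 r) + sqrte (pB v2 r))))%E).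
  apply: le_integral_nonmeasurable => r; rewrite /= in_itv/= andbT => r1.
    apply: opnorm_ge0; rewrite /= linear0; apply/val_inj/funext => i /=.
    rewrite funNE; first exact: scaler0.
    by exists M => k; exact: thetaM.
  by apply: opnorm_localization_le => //; exact: addr_ge0.
have A0 : 0 <= 2 * C * (M1 + M2) by rewrite !mulr_ge0 ?addr_ge0.
have S0 (r : R) : (0 <= sqrte (nB v1 r) + sqrte (pB v2 r))%E.
  by rewrite adde_ge0 ?sqrte_ge0.
(* The majorant is measurable, so its integral splits into a multiple of the integral of
   [1 / (1 + r^2)] and a multiple of the one assumed finite. *)
rewrite ge0_integralD//; last 4 first.
- by move=> r _; rewrite mule_ge0.
- by apply: measurable_funeM; exact: measurable_oneDsqrV.
- by move=> r _; rewrite mule_ge0.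
- by apply: measurable_funeM; exact: mS.
rewrite ge0_integralZl//; last exact: measurable_oneDsqrV.
rewrite ge0_integralZl//; last exact: mS.
rewrite lte_add_pinfty// lte_mul_pinfty//; exact: integral_oneDsqrV_lty.
Qed.
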